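(* Let $M^{2n+s}(f,Q,\xi_i,\eta^i,g)$ be a weak $f$-contact manifold with Levi-Civita connection $\nabla$ of $g$. Then $M$ is weak $f$-K-contact if and only if $\nabla\,\xi_i=-f$ for all $1\le i\le s$, i.e. $\nabla_X\,\xi_i=-fX$ for every vector field $X$ and every $i$.
   Context: Let $n,s\ge1$ and let $M=M^{2n+s}$ be a smooth manifold of dimension $2n+s$. A weak metric $f$-structure on $M$ is a set $(f,Q,\xi_i,\eta^i,g)$ $(i=1,\dots,s)$, where $f$ is a $(1,1)$-tensor, $Q$ is a nonsingular $(1,1)$-tensor, $\xi_i$ are vector fields (the characteristic vector fields), $\eta^i$ are 1-forms and $g$ is a Riemannian metric, such that $$f^2=-Q+\sum_i\eta^i\otimes\xi_i,\quad \eta^i(\xi_j)=\delta^i_j,\quad Q\,\xi_i=\xi_i,$$ the $2n$-dimensional distribution $\mathcal D:=\bigcap_i\ker\eta^i$ is $f$-invariant ($fX\in\mathcal D$ for $X\in\mathcal D$), and $$g(fX,fY)=g(X,QY)-\sum_i\eta^i(X)\,\eta^i(Y)$$ for all vector fields $X,Y$. Put $\Phi(X,Y)=g(X,fY)$. The exterior derivative of a 1-form is normalized by $d\eta(X,Y)=\frac12\{X(\eta(Y))-Y(\eta(X))-\eta([X,Y])\}$. The structure is weak $f$-contact if $\Phi=d\eta^1=\dots=d\eta^s$; a weak $f$-contact structure is weak $f$-K-contact if all the vector fields $\xi_i$ are Killing for $g$. A manifold with such a structure is called a weak $f$-contact (respectively weak $f$-K-contact) manifold. *)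

(* Defs.v *)
From HB Require Import structures.
From mathcomp Require Import all_boot all_order all_algebra.
From mathcomp Require Import all_classical all_reals all_analysis.
From mathcomp Require Import ring.

Set Implicit Arguments.
Unset Strict Implicit.
Unset Printing Implicit Defensive.

Import Order.TTheory GRing.Theory Num.Theory numFieldNormedType.Exports.

Local Open Scope classical_set_scope.
Local Open Scope ring_scope.

Section CkFunctions.
Context {R : realType} {m : nat}.
Implicit Types (U : set 'rV[R]_m) (f g : 'rV[R]_m -> R).

(* Meant for open U only: then continuity and partial derivatives at the points
   of U do not depend on the values of f outside U. *)
Fixpoint Ck (k : nat) U f : Prop :=
  (forall x, U x -> {for x, continuous f}) /\
  if k is k'.+1 then
    forall i : 'I_m,
      (forall x, U x -> derivable f x (delta_mx 0 i)) /\
      Ck k' U ('D_(delta_mx 0 i) f)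
  else True.

Definition smooth_on U f := forall k, Ck k U f.

Lemma Ck_continuous k U f : Ck k U f -> forall x, U x -> {for x, continuous f}.
Proof. by case: k => [|k] []. Qed.

Lemma CkW k U f : Ck k.+1 U f -> Ck k U f.
Proof.
elim: k f => [|k IH] f [cf df]; first by split.
by split=> // i; have [? ?] := df i; split=> //; exact: IH.
Qed.

Lemma eq_Ck k U f g : open U -> (forall x, U x -> f x = g x) ->
  Ck k U f -> Ck k U g.
Proof.
move=> oU; elim: k f g => [|k IH] f g fg Cf; have nfg x : U x ->
    \near x, f x = g x by move=> Ux; apply: filterS fg _; exact: open_nbhs_nbhs.
all: have cg x (Ux : U x) : {for x, continuous g} by
  rewrite /prop_for /continuous_at -fg//; apply: cvg_trans (Ck_continuous Cf Ux);
  exact: near_eq_cvg (nfg x Ux).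
  by [].
split=> // i; have [dfi Cfi] := Cf.2 i.
split=> [x Ux|]; first exact: near_eq_derivable (nfg _ Ux) (dfi _ Ux).
by apply: IH Cfi => x Ux; exact: near_eq_derive (nfg _ Ux).
Qed.

Lemma Ck_cst k U a : open U -> Ck k U (cst a).
Proof.
move=> oU; elim: k a => [|k IH] a; split=> //; try by move=> x _; exact: cst_continuous.
move=> i; split=> [x _|]; first exact: derivable_cst.
by apply: eq_Ck (IH 0) => // x _; rewrite derive_cst.
Qed.

Lemma CkD k U f g : open U -> Ck k U f -> Ck k U g -> Ck k U (f + g).
Proof.
move=> oU; elim: k f g => [|k IH] f g [cf df] [cg dg].
  by split=> // x Ux; apply: continuousD; [exact: cf|exact: cg].
split=> [x Ux|i]; first by apply: continuousD; [exact: cf|exact: cg].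
have [dfi Cfi] := df i; have [dgi Cgi] := dg i.
split=> [x Ux|]; first by apply: derivableD; [exact: dfi|exact: dgi].
apply: (eq_Ck oU _ (IH _ _ Cfi Cgi)) => x Ux.
by rewrite deriveD//; [exact: dfi|exact: dgi].
Qed.

Lemma CkM k U f g : open U -> Ck k U f -> Ck k U g -> Ck k U (f * g).
Proof.
move=> oU; elim: k f g => [|k IH] f g Cf Cg; have [cf df] := Cf;
    have [cg dg] := Cg.
  by split=> // x Ux; apply: continuousM; [exact: cf|exact: cg].
split=> [x Ux|i]; first by apply: continuousM; [exact: cf|exact: cg].
have [dfi Cfi] := df i; have [dgi Cgi] := dg i.
split=> [x Ux|]; first by apply: derivableM; [exact: dfi|exact: dgi].
have := CkD oU (IH _ _ (CkW Cf) Cgi) (IH _ _ (CkW Cg) Cfi).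
apply: (eq_Ck oU) => x Ux.
by rewrite deriveM//; [exact: dfi|exact: dgi].
Qed.

End CkFunctions.

(* [chart_inv] is total, but only its values on [chart_cod c] matter. *)
Record chart (R : realType) (m : nat) (T : topologicalType) := Chart {
  chart_dom : set T;
  chart_map :> T -> 'rV[R]_m;
  chart_inv : 'rV[R]_m -> T;
  chart_dom_open : open chart_dom;
  chart_cod_open : open (chart_map @` chart_dom);
  chart_mapK : forall x, chart_dom x -> chart_inv (chart_map x) = x;
  chart_map_continuous :
    forall x, chart_dom x -> {for x, continuous chart_map};
  chart_inv_continuous :
    forall x, (chart_map @` chart_dom) x -> {for x, continuous chart_inv} }.

Definition chart_cod R m T (c : chart R m T) : set 'rV[R]_m :=
  c @` chart_dom c.

Definition compatible R m T (c d : chart R m T) :=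
  forall j : 'I_m,
    smooth_on (c @` (chart_dom c `&` chart_dom d))
              (fun x => d (chart_inv c x) 0 j).

Record smoothManifold (R : realType) (m : nat) := SmoothManifold {
  manifold_space :> topologicalType;
  manifold_hausdorff : hausdorff_space manifold_space;
  manifold_second_countable : @second_countable manifold_space;
  atlas : set (chart R m manifold_space);
  atlas_cover : forall p, exists2 c, atlas c & chart_dom c p;
  atlas_compatible : forall c d, atlas c -> atlas d -> compatible c d }.

Section SmoothFunctions.
Context {R : realType} {m : nat} (M : smoothManifold R m).

Definition smooth_fun : {pred M -> R^o} := fun h =>
  `[< forall c, atlas c -> smooth_on (chart_cod c) (h \o chart_inv c) >].

Lemma smooth_fun_cst a : cst a \in smooth_fun.
Proof.
apply/asboolP => c _ k.
by apply: (@Ck_cst R m k (chart_cod c) a); exact: chart_cod_open.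
Qed.

Lemma smooth_funD h k :
  h \in smooth_fun -> k \in smooth_fun -> h + k \in smooth_fun.
Proof.
move=> /asboolP sh /asboolP sk; apply/asboolP => c ac l.
rewrite (_ : _ \o _ = (h \o chart_inv c) + (k \o chart_inv c))//.
by apply: CkD; [exact: chart_cod_open|exact: sh|exact: sk].
Qed.

Lemma smooth_funM h k :
  h \in smooth_fun -> k \in smooth_fun -> h * k \in smooth_fun.
Proof.
move=> /asboolP sh /asboolP sk; apply/asboolP => c ac l.
rewrite (_ : _ \o _ = (h \o chart_inv c) * (k \o chart_inv c))//.
by apply: CkM; [exact: chart_cod_open|exact: sh|exact: sk].
Qed.

Lemma smooth_funZ a h :
  h \in smooth_fun -> a *: h \in smooth_fun.
Proof. by move=> sh; exact: smooth_funM (smooth_fun_cst a) sh. Qed.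

Lemma smooth_fun_subring : subring_closed smooth_fun.
Proof.
split=> [|h k sh sk|]; [exact: smooth_fun_cst| |exact: smooth_funM].
apply: smooth_funD => //; rewrite -mulN1r; apply: smooth_funM => //.
exact: (smooth_fun_cst (-1)).
Qed.

HB.instance Definition _ :=
  GRing.isSubringClosed.Build (M -> R^o) smooth_fun smooth_fun_subring.
HB.instance Definition _ :=
  GRing.isScaleClosed.Build R (M -> R^o) smooth_fun smooth_funZ.

Record smooth := Smooth {
  smooth_val :> M -> R^o;
  smooth_valP : smooth_val \in smooth_fun }.

HB.instance Definition _ := [isSub for smooth_val].
HB.instance Definition _ := [Choice of smooth by <:].
HB.instance Definition _ :=
  GRing.SubChoice_isSubComPzRing.Build _ _ smooth (GRing.subringClosedP _).
HB.instance Definition _ := [SubZmodule_isSubLmodule of smooth by <:].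

Lemma smoothP (h k : smooth) : (forall p, h p = k p) -> h = k.
Proof. by move=> hk; apply/val_inj/funext. Qed.

End SmoothFunctions.

Arguments smooth_fun {R m} M _.

Section TangentSpaces.
Context {R : realType} {m : nat} {M : smoothManifold R m}.

(* T_pM is the space of derivations at p of the algebra of smooth functions. *)
Definition derivation (p : M) : {pred smooth M -> R^o} := fun D =>
  `[< (forall a h k, D (a *: h + k) = a * D h + D k) /\
      (forall h k, D (h * k) = h p * D k + k p * D h) >].

Lemma derivation_submod p : submod_closed (derivation p).
Proof.
split=> [|a D E /asboolP[DL DM] /asboolP[EL EM]].
  apply/asboolP; split=> [a h k|h k]; first by rewrite mulr0 addr0.
  by rewrite !mulr0 addr0.
have FE h : (a *: D + E) h = a * D h + E h by [].
apply/asboolP; split=> [b h k|h k]; first by rewrite !FE DL EL; ring.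
by rewrite !FE DM EM; ring.
Qed.

HB.instance Definition _ p :=
  GRing.isSubmodClosed.Build R (smooth M -> R^o) (derivation p)
    (derivation_submod p).

Record tangent (p : M) := Tangent {
  tangent_val :> smooth M -> R^o;
  tangent_valP : tangent_val \in derivation p }.

HB.instance Definition _ p := [isSub for @tangent_val p].
HB.instance Definition _ p := [Choice of tangent p by <:].
HB.instance Definition _ p := [SubChoice_isSubLmodule of tangent p by <:].

Lemma tangentP p (v w : tangent p) : (forall h, v h = w h) -> v = w.
Proof. by move=> vw; apply/val_inj/funext. Qed.

End TangentSpaces.

Section VectorFields.
Context {R : realType} {m : nat} (M : smoothManifold R m).

Definition rough_field := forall p : M, tangent p.
Implicit Types X Y Z : rough_field.

HB.instance Definition _ := gen_eqMixin rough_field.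
HB.instance Definition _ := gen_choiceMixin rough_field.

Lemma rough_fieldP X Y : (forall p, X p = Y p) -> X = Y.
Proof. by move=> XY; apply: functional_extensionality_dep. Qed.

Program Definition rough_field_zmod := @GRing.isZmodule.Build rough_field
  (fun p => 0) (fun X p => - X p) (fun X Y p => X p + Y p) _ _ _ _.
Next Obligation. by move=> X Y Z; apply: rough_fieldP => p; rewrite addrA. Qed.
Next Obligation. by move=> X Y; apply: rough_fieldP => p; rewrite addrC. Qed.
Next Obligation. by move=> X; apply: rough_fieldP => p; rewrite add0r. Qed.
Next Obligation. by move=> X; apply: rough_fieldP => p; rewrite addNr. Qed.
HB.instance Definition _ := rough_field_zmod.

Program Definition rough_field_lmod :=
  @GRing.Zmodule_isLmodule.Build (smooth M) rough_field
    (fun h X p => h p *: X p) _ _ _ _.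
Next Obligation. by move=> h k X; apply: rough_fieldP => p; rewrite scalerA. Qed.
Next Obligation. by move=> X; apply: rough_fieldP => p; rewrite scale1r. Qed.
Next Obligation.
by move=> h X Y; apply: rough_fieldP => p; rewrite scalerDr.
Qed.
Next Obligation.
by move=> X h k; apply: rough_fieldP => p; rewrite scalerDl.
Qed.
HB.instance Definition _ := rough_field_lmod.

(* Smoothness of vector fields and of tensor fields is tested on global smooth
   functions and global smooth vector fields; on a Hausdorff second countable
   manifold this agrees with smoothness of the components in charts. *)
Definition smooth_field : {pred rough_field} := fun X =>
  `[< forall h : smooth M, (fun p => X p h) \in smooth_fun M >].

Lemma smooth_field_submod : submod_closed smooth_field.
Proof.
split=> [|h X Y /asboolP sX /asboolP sY]; apply/asboolP => k.
  exact: (rpred0 (smooth_fun M)).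
have := rpredD (rpredM (smooth_valP h) (sX k)) (sY k).
by [].
Qed.

HB.instance Definition _ :=
  GRing.isSubmodClosed.Build (smooth M) rough_field smooth_field
    smooth_field_submod.

Record vfield := VField {
  vfield_val : rough_field;
  vfield_valP : vfield_val \in smooth_field }.

HB.instance Definition _ := [isSub for vfield_val].
HB.instance Definition _ := [Choice of vfield by <:].
HB.instance Definition _ := [SubChoice_isSubLmodule of vfield by <:].

Definition vfield_at (X : vfield) : forall p, tangent p := vfield_val X.
Coercion vfield_at : vfield >-> Funclass.

Lemma vfieldP (X Y : vfield) : (forall p, X p = Y p) -> X = Y.
Proof. by move=> XY; apply/val_inj/rough_fieldP. Qed.

End VectorFields.

Arguments smooth_field {R m} M _.

Section Bracket.
Context {R : realType} {m : nat} {M : smoothManifold R m}.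
Implicit Types X Y Z : vfield M.

Lemma vact_smooth X (h : smooth M) : (fun p => X p h) \in smooth_fun M.
Proof. by have /asboolP := vfield_valP X; exact. Qed.

(* The function X(h). *)
Definition vact X (h : smooth M) : smooth M := Smooth (vact_smooth X h).

Lemma vact_linear X a (h k : smooth M) :
  vact X (a *: h + k) = a *: vact X h + vact X k.
Proof.
by apply: smoothP => p; have /asboolP[XL _] := tangent_valP (X p); exact: XL.
Qed.

Lemma vactM X (h k : smooth M) : vact X (h * k) = h * vact X k + k * vact X h.
Proof.
by apply: smoothP => p; have /asboolP[_ XM] := tangent_valP (X p); exact: XM.
Qed.

Lemma lie_subproof X Y p :
  (fun h => X p (vact Y h) - Y p (vact X h)) \in derivation p.
Proof.
have /asboolP[XL XM] := tangent_valP (X p).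
have /asboolP[YL YM] := tangent_valP (Y p).
have XD h k : X p (h + k) = X p h + X p k.
  by have := XL 1 h k; rewrite scale1r mul1r.
have YD h k : Y p (h + k) = Y p h + Y p k.
  by have := YL 1 h k; rewrite scale1r mul1r.
apply/asboolP; split=> [a h k|h k]; first by rewrite !vact_linear XL YL; ring.
rewrite !vactM XD YD !XM !YM.
by rewrite /vact/=; ring.
Qed.

Definition lie_rough X Y : rough_field M := fun p => Tangent (lie_subproof X Y p).

Lemma lie_smooth X Y : lie_rough X Y \in smooth_field M.
Proof.
by apply/asboolP => h; exact: rpredB (vact_smooth X (vact Y h))
  (vact_smooth Y (vact X h)).
Qed.

(* [X, Y]_p h = X_p (Y h) - Y_p (X h) *)
Definition lie X Y : vfield M := VField (lie_smooth X Y).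

End Bracket.

Section Tensors.
Context {R : realType} {m : nat} (M : smoothManifold R m).

Record oneForm := OneForm {
  oneForm_at : forall p : M, {linear tangent p -> R^o};
  oneForm_smooth : forall X : vfield M,
    (fun p => oneForm_at p (X p)) \in smooth_fun M }.

Definition oneForm_app (a : oneForm) (X : vfield M) : smooth M :=
  Smooth (oneForm_smooth a X).
Coercion oneForm_app : oneForm >-> Funclass.

Record tensor11 := Tensor11 {
  tensor11_at : forall p : M, {linear tangent p -> tangent p};
  tensor11_smooth : forall X : vfield M,
    ((fun p => tensor11_at p (X p)) : rough_field M) \in smooth_field M }.

Definition tensor11_app (A : tensor11) (X : vfield M) : vfield M :=
  VField (tensor11_smooth A X).
Coercion tensor11_app : tensor11 >-> Funclass.

Record riemannianMetric := RiemannianMetric {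
  riem_at : forall p : M, tangent p -> {linear tangent p -> R^o};
  riem_sym : forall (p : M) (v w : tangent p), riem_at v w = riem_at w v;
  riem_pos : forall (p : M) (v : tangent p), v != 0 -> 0 < riem_at v v;
  riem_smooth : forall X Y : vfield M,
    (fun p => riem_at (X p) (Y p)) \in smooth_fun M }.

Definition riem_app (g : riemannianMetric) (X Y : vfield M) : smooth M :=
  Smooth (riem_smooth g X Y).
Coercion riem_app : riemannianMetric >-> Funclass.

(* The normalization of d includes the factor 1/2. *)
Definition ext_deriv (a : oneForm) (X Y : vfield M) : smooth M :=
  2^-1 *: (vact X (a Y) - vact Y (a X) - a (lie X Y)).

Definition Lie_metric (Z : vfield M) (g : riemannianMetric) (X Y : vfield M) : smooth M :=
  vact Z (g X Y) - g (lie Z X) Y - g X (lie Z Y).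

Definition Killing (g : riemannianMetric) (Z : vfield M) :=
  forall X Y, Lie_metric Z g X Y = 0.

Record connection := Connection {
  nabla :> vfield M -> vfield M -> vfield M;
  nabla_linearl : forall (h : smooth M) X Y Z,
    nabla (h *: X + Y) Z = h *: nabla X Z + nabla Y Z;
  nabla_addr : forall X Y Z, nabla X (Y + Z) = nabla X Y + nabla X Z;
  nabla_leibniz : forall X (h : smooth M) Y,
    nabla X (h *: Y) = vact X h *: Y + h *: nabla X Y }.

Definition Levi_Civita (g : riemannianMetric) (D : connection) :=
  (forall X Y, D X Y - D Y X = lie X Y) /\
  (forall X Y Z, vact X (g Y Z) = g (D X Y) Z + g Y (D X Z)).

End Tensors.

(* The dimension of M is a separate parameter of the manifold; when it is
   2n + s, [wf_eta_xi] forces the intersection of the kernels of the eta^i to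
   have rank 2n. *)
Record weak_metric_f_structure (R : realType) (m : nat)
    (M : smoothManifold R m) (s : nat) := WeakMetricFStructure {
  wf_f : tensor11 M;
  wf_Q : tensor11 M;
  wf_xi : 'I_s -> vfield M;
  wf_eta : 'I_s -> oneForm M;
  wf_g : riemannianMetric M;
  wf_Q_nonsingular : forall p : M, bijective (tensor11_at wf_Q p);
  wf_f2 : forall X,
    wf_f (wf_f X) = - wf_Q X + \sum_i wf_eta i X *: wf_xi i;
  wf_eta_xi : forall i j, wf_eta i (wf_xi j) = (i == j)%:R;
  wf_Q_xi : forall i, wf_Q (wf_xi i) = wf_xi i;
  wf_f_invariant : forall X,
    (forall i, wf_eta i X = 0) -> forall i, wf_eta i (wf_f X) = 0;
  wf_compatible : forall X Y,
    wf_g (wf_f X) (wf_f Y) =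
    wf_g X (wf_Q Y) - \sum_i wf_eta i X * wf_eta i Y }.

Section WeakFContact.
Context {R : realType} {m s : nat} {M : smoothManifold R m}.
Variable S : weak_metric_f_structure M s.

Definition fundamental_form (X Y : vfield M) : smooth M :=
  wf_g S X (wf_f S Y).

Definition weak_f_contact :=
  forall (i : 'I_s) X Y, fundamental_form X Y = ext_deriv (wf_eta S i) X Y.

Definition weak_f_K_contact :=
  weak_f_contact /\ forall i, Killing (wf_g S) (wf_xi S i).

End WeakFContact.

(* Main.v *)
Require Import Defs.
From mathcomp Require Import all_boot all_order all_algebra.
From mathcomp Require Import all_classical all_reals all_analysis.
From mathcomp Require Import ring.

(** Antisymmetry of [d eta^1] makes [f] skew-symmetric; as
    [f (f xi_i) = - Q xi_i + xi_i = 0], this gives [|f xi_i|^2 = 0], and the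
    compatibility condition then reads [eta^i = g(-, xi_i)].  For a metric
    connection without torsion, [2 d eta^i(X, Y)] and [(L_{xi_i} g)(X, Y)] are
    therefore twice the antisymmetric and symmetric parts of [nabla xi_i].  The
    contact condition equates the former with [- f], so [xi_i] is Killing
    exactly when the latter vanishes, that is when [nabla xi_i = - f]. *)

Import Order.TTheory GRing.Theory Num.Theory.
Local Open Scope ring_scope.

Section RiemannianMetric.
Context {R : realType} {m : nat} {M : smoothManifold R m}.
Variable g : riemannianMetric M.
Implicit Types X Y Z : vfield M.

Lemma riem_appC X Y : g X Y = g Y X.
Proof. by apply: smoothP => p; exact: riem_sym. Qed.

Lemma riem_app0r X : g X 0 = 0.
Proof. by apply: smoothP => p; exact: (linear0 (riem_at g (X p))). Qed.

Lemma riem_appDr X Y Z : g X (Y + Z) = g X Y + g X Z.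
Proof. by apply: smoothP => p; exact: (linearD (riem_at g (X p))). Qed.

Lemma riem_appNr X Y : g X (- Y) = - g X Y.
Proof. by apply: smoothP => p; exact: (linearN (riem_at g (X p))). Qed.

Lemma riem_appBr X Y Z : g X (Y - Z) = g X Y - g X Z.
Proof. by rewrite riem_appDr riem_appNr. Qed.

Lemma riem_app_eq0 X : g X X = 0 -> X = 0.
Proof.
move=> gXX; apply: vfieldP => p; apply/eqP; apply: contraT => Xp_neq0.
have := riem_pos g Xp_neq0.
have -> : riem_at g (X p) (X p) = g X X p by [].
by rewrite gXX ltxx.
Qed.

(** Nondegeneracy of [g], obtained by testing against [Z = X - Y]. *)
Lemma riem_app_inj X Y : (forall Z, g Z X = g Z Y) -> X = Y.
Proof.
move=> gXY; apply/eqP; rewrite -subr_eq0; apply/eqP/riem_app_eq0.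
by rewrite riem_appBr gXY subrr.
Qed.

Variable D : connection M.
Hypothesis hD : Levi_Civita g D.

(** Metric compatibility expands [Z(g(X, Y))]; replacing the brackets by zero torsion cancels every
    term in [D Z X] and [D Z Y]. *)
Lemma Lie_metric_Levi_Civita Z X Y :
  Lie_metric Z g X Y = g Y (D X Z) + g X (D Y Z).
Proof.
rewrite /Lie_metric hD.2 -!hD.1 !(riem_appC _ Y) !riem_appBr.
by ring.
Qed.

(** For the metric dual [a] of [Z], the terms [g (D X Y) Z] and [g (D Y X) Z] cancel against
    [a (lie X Y)]. *)
Lemma ext_deriv_Levi_Civita (a : oneForm M) Z :
  (forall X, a X = g X Z) ->
  forall X Y, ext_deriv a X Y = 2^-1 *: (g Y (D X Z) - g X (D Y Z)).
Proof.
move=> aE X Y; rewrite /ext_deriv !aE !hD.2 -hD.1 riem_appC !(riem_appC _ Z).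
by rewrite riem_appBr; congr (_ *: _); ring.
Qed.

End RiemannianMetric.

Lemma ext_deriv_antisym {R : realType} {m : nat} {M : smoothManifold R m}
    (a : oneForm M) (X Y : vfield M) : ext_deriv a X Y = - ext_deriv a Y X.
Proof.
rewrite /ext_deriv -scalerN; congr (_ *: _).
have -> : lie X Y = - lie Y X.
  apply: vfieldP => p; apply: tangentP => h.
  by rewrite -[RHS]/(- (Y p (vact X h) - X p (vact Y h))) opprB.
have -> : a (- lie Y X) = - a (lie Y X).
  by apply: smoothP => p; exact: (linearN (oneForm_at a p)).
by ring.
Qed.

Section WeakFContact.
Context {R : realType} {m s : nat} {M : smoothManifold R m}.
Variable S : weak_metric_f_structure M s.
Local Notation f := (wf_f S).
Local Notation g := (wf_g S).
Local Notation xi := (wf_xi S).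
Local Notation eta := (wf_eta S).

Lemma wf_f2_xi i : f (f (xi i)) = 0.
Proof.
rewrite wf_f2 wf_Q_xi (bigD1 i)//= wf_eta_xi eqxx scale1r big1 ?addr0 ?addNr//.
by move=> j /negPf ji; rewrite wf_eta_xi ji scale0r.
Qed.

Hypothesis hS : weak_f_contact S.

Lemma weak_f_contact_skew (i : 'I_s) X Y : g X (f Y) = - g Y (f X).
Proof. by have := ext_deriv_antisym (eta i) X Y; rewrite -!hS. Qed.

Lemma weak_f_contact_f_xi i : f (xi i) = 0.
Proof.
apply: (riem_app_eq0 g).
by rewrite (weak_f_contact_skew i) wf_f2_xi riem_app0r oppr0.
Qed.

Lemma weak_f_contact_eta i X : eta i X = g X (xi i).
Proof.
have := wf_compatible S X (xi i).
(* With [xi i] as second argument, the left side vanishes and only the [i]-th summand survives. *)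
rewrite weak_f_contact_f_xi riem_app0r wf_Q_xi (bigD1 i)//= wf_eta_xi eqxx.
rewrite mulr1 big1 ?addr0 => [/esym/eqP|j /negPf ji].
  by rewrite subr_eq0 => /eqP.
by rewrite wf_eta_xi ji mulr0.
Qed.

End WeakFContact.

Theorem theorem4p1 (R : realType) (n s : nat) (hn : (1 <= n)%N)
    (hs : (1 <= s)%N) (M : smoothManifold R (2 * n + s)%N)
    (S : weak_metric_f_structure M s) (D : connection M)
    (hD : Levi_Civita (wf_g S) D) (hS : weak_f_contact S) :
  weak_f_K_contact S <->
  forall (i : 'I_s) (X : vfield M), D X (wf_xi S i) = - wf_f S X.
Proof.
split=> [[_ K] i X|Dxi].
  apply: (riem_app_inj (wf_g S)) => Y.
  have := K i X Y; rewrite (Lie_metric_Levi_Civita _ _ hD) => /eqP.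
  (* The Killing equation makes [nabla xi_i] skew, so the two halves in [d eta^i] add up to
     [g Y (D X xi_i)]. *)
  rewrite addr_eq0 => /eqP symD; rewrite riem_appNr -(weak_f_contact_skew _ hS i).
  have := hS i X Y; rewrite /fundamental_form => ->.
  rewrite (ext_deriv_Levi_Civita _ _ hD _ _ (weak_f_contact_eta _ hS i)) symD.
  by rewrite scalerDr -scalerDl -[2^-1]mul1r -splitr scale1r.
(* Conversely, skewness of [f] cancels the two terms of the Lie derivative. *)
split=> // i X Y; rewrite (Lie_metric_Levi_Civita _ _ hD) !Dxi !riem_appNr.
by rewrite (weak_f_contact_skew _ hS i) opprK subrr.
Qed.
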